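(* Let $(M,d)$ be a complete multiplicative metric space, let $\xi,\eta,\lambda$ be real numbers with $\xi\in[0,1)$ and $\eta,\lambda\in[0,\frac12)$, and let $T:M\to M$ be a function such that for each pair of different points $x,y\in M$ at least one of the following conditions is satisfied: (1) $d(Tx,Ty)\le (d(x,y))^{\xi}$; (2) $d(Tx,Ty)\le \big(d(x,Tx)\cdot d(y,Ty)\big)^{\eta}$; (3) $d(Tx,Ty)\le \big(d(x,Ty)\cdot d(y,Tx)\big)^{\lambda}$. Then $T$ has a unique fixed point.
   Context: A multiplicative metric on a nonempty set $X$ is a mapping $d:X\times X\to\mathbb{R}$ such that for all $x,y,z\in X$: $d(x,y)\ge 1$; $d(x,y)=1$ if and only if $x=y$; $d(x,y)=d(y,x)$; and $d(x,z)\le d(x,y)\cdot d(y,z)$. The pair $(X,d)$ is called a multiplicative metric space. A sequence $\{x_n\}$ in $X$ converges (multiplicatively) to $x\in X$ if for every $\epsilon>1$ there is a positive integer $n_0$ with $d(x_n,x)<\epsilon$ for all $n\ge n_0$. It is a multiplicative Cauchy sequence if for every $\epsilon>1$ there is a positive integer $n_0$ with $d(x_n,x_m)<\epsilon$ for all $n,m\ge n_0$. The space $(X,d)$ is complete if every multiplicative Cauchy sequence in $X$ converges (multiplicatively) to a point of $X$. *)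

(* Defs.v *)
From Stdlib Require Import Reals.
Open Scope R_scope.

Record multiplicative_metric (M : Type) (d : M -> M -> R) : Prop := {
  mm_ge1 : forall x y, 1 <= d x y;
  mm_eq1 : forall x y, d x y = 1 <-> x = y;
  mm_sym : forall x y, d x y = d y x;
  mm_tri : forall x y z, d x z <= d x y * d y z
}.

Definition mult_converges (M : Type) (d : M -> M -> R) (u : nat -> M) (x : M) : Prop :=
  forall eps : R, 1 < eps ->
    exists n0 : nat, (0 < n0)%nat /\
      forall n : nat, (n0 <= n)%nat -> d (u n) x < eps.

Definition mult_Cauchy (M : Type) (d : M -> M -> R) (u : nat -> M) : Prop :=
  forall eps : R, 1 < eps ->
    exists n0 : nat, (0 < n0)%nat /\
      forall n m : nat, (n0 <= n)%nat -> (n0 <= m)%nat -> d (u n) (u m) < eps.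

Definition mult_complete (M : Type) (d : M -> M -> R) : Prop :=
  forall u : nat -> M, mult_Cauchy M d u -> exists x : M, mult_converges M d u x.

(* Main.v *)
Require Import Defs.
From Stdlib Require Import Reals Lra Lia Classical.
Open Scope R_scope.

(** Taking logarithms turns [d] into an ordinary metric [rho = ln d] and the
    three alternatives into Zamfirescu's additive ones.  With [delta] the
    maximum of [xi], [eta / (1 - eta)] and [lambda / (1 - lambda)], the triangle
    inequality reduces all three to the single estimate
    [rho (T x) (T y) <= delta * (rho x y + 2 * rho y (T x))].  Taking [y = T x]
    gives geometric decay along orbits, hence convergence; taking [x] on an orbit
    and [y] its limit shows that the limit is fixed.  Uniqueness is read off the
    three alternatives directly. *)

(** Moving [k * r] to the left leaves [(1 - k) * r <= k * S], whence the factor [k / (1 - k)]. *)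
Lemma le_absorb (k delta r S : R) (hk : k < 1) (hd : k / (1 - k) <= delta)
  (hS : 0 <= S) (h : r <= k * (S + r)) : r <= delta * S.
Proof.
  apply Rle_trans with (k / (1 - k) * S).
  - apply Rmult_le_reg_l with (1 - k); [lra|].
    replace ((1 - k) * (k / (1 - k) * S)) with (k * S) by (field; lra).
    lra.
  - now apply Rmult_le_compat_r.
Qed.

Lemma div_compl_lt_1 (k : R) (hk : k < 1 / 2) : k / (1 - k) < 1.
Proof.
  apply Rmult_lt_reg_r with (1 - k); [lra|].
  replace (k / (1 - k) * (1 - k)) with k by (field; lra).
  lra.
Qed.

Lemma ln_le_compat (a b : R) (ha : 0 < a) (hab : a <= b) : ln a <= ln b.
Proof.
  destruct hab as [hab | <-]; [left; now apply ln_increasing | right; reflexivity].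
Qed.

Section LogMetric.

Context (M : Type) (d : M -> M -> R) (d_metric : multiplicative_metric M d).

Definition log_dist (x y : M) : R := ln (d x y).

Local Notation rho := log_dist.

Lemma mm_gt0 (x y : M) : 0 < d x y.
Proof. pose proof (mm_ge1 M d d_metric x y); lra. Qed.

Lemma log_dist_ge0 (x y : M) : 0 <= rho x y.
Proof.
  unfold log_dist; rewrite <- ln_1.
  apply ln_le_compat; [lra | apply (mm_ge1 M d d_metric)].
Qed.

Lemma log_dist_refl (x : M) : rho x x = 0.
Proof.
  unfold log_dist; replace (d x x) with 1; [apply ln_1|].
  symmetry; now apply (mm_eq1 M d d_metric).
Qed.

Lemma log_dist_eq0 (x y : M) (h : rho x y = 0) : x = y.
Proof.
  apply (mm_eq1 M d d_metric), ln_inv; [apply mm_gt0 | lra |].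
  now rewrite ln_1.
Qed.

Lemma log_dist_sym (x y : M) : rho x y = rho y x.
Proof. unfold log_dist; now rewrite (mm_sym M d d_metric). Qed.

Lemma log_dist_tri (x y z : M) : rho x z <= rho x y + rho y z.
Proof.
  unfold log_dist; rewrite <- ln_mult by apply mm_gt0.
  apply ln_le_compat; [apply mm_gt0 | apply (mm_tri M d d_metric)].
Qed.

Lemma log_dist_le_Rpower (x y : M) (a k : R) (h : d x y <= Rpower a k) :
  rho x y <= k * ln a.
Proof.
  unfold log_dist; rewrite <- (ln_exp (k * ln a)).
  apply ln_le_compat; [apply mm_gt0 | exact h].
Qed.

Lemma log_dist_lt (x y : M) (e : R) : rho x y < e <-> d x y < exp e.
Proof.
  unfold log_dist; split; intro h.
  - rewrite <- (exp_ln (d x y)) by apply mm_gt0.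
    now apply exp_increasing.
  - rewrite <- (ln_exp e).
    apply ln_increasing; [apply mm_gt0 | exact h].
Qed.

Lemma log_dist_complete (d_complete : mult_complete M d) (u : nat -> M)
  (hu : forall e, 0 < e -> exists N, forall n m,
        (N <= n)%nat -> (N <= m)%nat -> rho (u n) (u m) < e) :
  exists z, forall e, 0 < e -> exists N, forall n, (N <= n)%nat -> rho (u n) z < e.
Proof.
  destruct (d_complete u) as [z hz].
  - intros eps heps.
    destruct (hu (ln eps)) as [N hN].
    { rewrite <- ln_1; apply ln_increasing; lra. }
    (* The successor only ensures that the index is positive. *)
    exists (S N); split; [lia|]; intros n m hn hm.
    rewrite <- (exp_ln eps) by lra.
    apply log_dist_lt, hN; lia.
  - exists z; intros e he.
    destruct (hz (exp e)) as [N [_ hN]].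
    { rewrite <- exp_0; now apply exp_increasing. }
    exists N; intros n hn; now apply log_dist_lt, hN.
Qed.

Lemma geometric_steps_Cauchy (u : nat -> M) (delta : R)
  (delta_range : 0 <= delta < 1)
  (hu : forall n, rho (u (S n)) (u (S (S n))) <= delta * rho (u n) (u (S n))) :
  forall e, 0 < e -> exists N, forall n m,
    (N <= n)%nat -> (N <= m)%nat -> rho (u n) (u m) < e.
Proof.
  set (r0 := rho (u 0%nat) (u 1%nat)).
  assert (hr0 : 0 <= r0) by apply log_dist_ge0.
  assert (step : forall n, rho (u n) (u (S n)) <= delta ^ n * r0).
  { induction n as [|n IH]; [simpl; unfold r0; lra|].
    apply Rle_trans with (1 := hu n).
    simpl; rewrite Rmult_assoc.
    apply Rmult_le_compat_l; [lra | exact IH]. }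
  (* Partial geometric sum, multiplied through by [1 - delta] so that the induction on [k] involves
     no division. *)
  assert (tail : forall n k, (1 - delta) * rho (u n) (u (n + k)%nat)
                             <= delta ^ n * r0 * (1 - delta ^ k)).
  { intros n k; induction k as [|k IH].
    - rewrite Nat.add_0_r, log_dist_refl; simpl; lra.
    - rewrite Nat.add_succ_r.
      pose proof (log_dist_tri (u n) (u (n + k)%nat) (u (S (n + k)))) as tri.
      pose proof (step (n + k)%nat) as st.
      rewrite pow_add in st; simpl pow.
      apply (Rmult_le_compat_l (1 - delta)) in tri; [|lra].
      apply (Rmult_le_compat_l (1 - delta)) in st; [|lra].
      lra. }
  assert (tail_le : forall N n, (N <= n)%nat ->
            (1 - delta) * rho (u N) (u n) <= delta ^ N * r0).
  { intros N n hn; replace n with (N + (n - N))%nat by lia.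
    apply Rle_trans with (1 := tail N (n - N)%nat).
    assert (0 <= delta ^ (n - N)) by (apply pow_le; lra).
    assert (0 <= delta ^ N * r0) by (apply Rmult_le_pos; [apply pow_le|]; lra).
    nra. }
  intros e he.
  (* Going from [u n] to [u m] through [u N] costs two tails, so
     [2 * delta ^ N * r0 < (1 - delta) * e] suffices; the [+ 1] keeps the denominator positive when
     [r0 = 0]. *)
  assert (hy : 0 < (1 - delta) * e / (2 * r0 + 1)).
  { apply Rdiv_lt_0_compat; [apply Rmult_lt_0_compat|]; lra. }
  destruct (pow_lt_1_zero delta) with (2 := hy) as [N hN].
  { rewrite Rabs_pos_eq; lra. }
  specialize (hN N (le_n N)).
  assert (hp : 0 <= delta ^ N) by (apply pow_le; lra).
  rewrite Rabs_pos_eq in hN by exact hp.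
  apply (Rmult_lt_compat_r (2 * r0 + 1)) in hN; [|lra].
  replace ((1 - delta) * e / (2 * r0 + 1) * (2 * r0 + 1)) with ((1 - delta) * e)
    in hN by (field; lra).
  exists N; intros n m hn hm.
  apply Rmult_lt_reg_l with (1 - delta); [lra|].
  pose proof (log_dist_tri (u n) (u N) (u m)) as tri.
  rewrite (log_dist_sym (u n) (u N)) in tri.
  apply (Rmult_le_compat_l (1 - delta)) in tri; [|lra].
  pose proof (tail_le N n hn); pose proof (tail_le N m hm).
  lra.
Qed.

Lemma fixed_point_of_estimate (d_complete : mult_complete M d) (T : M -> M)
  (delta : R) (delta_range : 0 <= delta < 1)
  (hT : forall x y, rho (T x) (T y) <= delta * (rho x y + 2 * rho y (T x)))
  (x0 : M) : exists z, T z = z.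
Proof.
  set (u := fun n => Nat.iter n T x0).
  destruct (log_dist_complete d_complete u) as [z hz].
  { apply geometric_steps_Cauchy with (1 := delta_range); intro n.
    change (u (S (S n))) with (T (u (S n))).
    pose proof (hT (u n) (u (S n))) as h.
    change (T (u n)) with (u (S n)) in h.
    rewrite (log_dist_refl (u (S n))) in h; lra. }
  exists z; apply log_dist_eq0, Rle_antisym; [|apply log_dist_ge0].
  apply le_epsilon; intros e he.
  (* Through [u (S N)], the distance from [T z] to [z] is at most [delta * (rho (u N) z + 2 * rho (u
     (S N)) z) + rho (u (S N)) z]: four distances below [e / 4], since [delta < 1]. *)
  destruct (hz (e / 4)) as [N hN]; [lra|].
  pose proof (hN N (le_n N)) as h0.
  pose proof (hN (S N) (le_S _ _ (le_n N))) as h1.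
  pose proof (hT (u N) z) as h.
  change (T (u N)) with (u (S N)) in h.
  rewrite (log_dist_sym z (u (S N))), (log_dist_sym (u (S N)) (T z)) in h.
  pose proof (log_dist_tri (T z) (u (S N)) z).
  pose proof (log_dist_ge0 (u N) z); pose proof (log_dist_ge0 (u (S N)) z).
  nra.
Qed.

(** In the last two alternatives, detours through [y] and [T x] bound the bracket by [rho x y + 2 *
    rho y (T x) + rho (T x) (T y)]; [le_absorb] then removes the final term. *)
Lemma zamfirescu_estimate (T : M -> M) (xi eta lambda delta : R)
  (eta_range : 0 <= eta < 1) (lambda_range : 0 <= lambda < 1)
  (delta_ge0 : 0 <= delta) (hxi : xi <= delta)
  (heta : eta / (1 - eta) <= delta) (hlambda : lambda / (1 - lambda) <= delta)
  (x y : M)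
  (h : rho (T x) (T y) <= xi * rho x y \/
       rho (T x) (T y) <= eta * (rho x (T x) + rho y (T y)) \/
       rho (T x) (T y) <= lambda * (rho x (T y) + rho y (T x))) :
  rho (T x) (T y) <= delta * (rho x y + 2 * rho y (T x)).
Proof.
  pose proof (log_dist_ge0 x y); pose proof (log_dist_ge0 y (T x)).
  pose proof (log_dist_tri y (T x) (T y)).
  destruct h as [h | [h | h]].
  - nra.
  - apply le_absorb with eta; try lra.
    apply Rle_trans with (1 := h), Rmult_le_compat_l; [lra|].
    pose proof (log_dist_tri x y (T x)); lra.
  - apply le_absorb with lambda; try lra.
    apply Rle_trans with (1 := h), Rmult_le_compat_l; [lra|].
    pose proof (log_dist_tri x y (T y)); lra.
Qed.

End LogMetric.

(* [Rpower a b] is [exp (b * ln a)], the usual real power for [a > 0]; every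
   base below is at least 1. *)
Theorem theorem3p1 (M : Type) (d : M -> M -> R) (xi eta lambda : R) (T : M -> M)
  (M_nonempty : inhabited M)
  (d_metric : multiplicative_metric M d)
  (d_complete : mult_complete M d)
  (xi_range : 0 <= xi < 1)
  (eta_range : 0 <= eta < 1 / 2)
  (lambda_range : 0 <= lambda < 1 / 2)
  (T_contr : forall x y : M, x <> y ->
     d (T x) (T y) <= Rpower (d x y) xi \/
     d (T x) (T y) <= Rpower (d x (T x) * d y (T y)) eta \/
     d (T x) (T y) <= Rpower (d x (T y) * d y (T x)) lambda) :
  exists! x : M, T x = x.
Proof.
  set (rho := log_dist M d).
  assert (contr : forall x y,
     rho (T x) (T y) <= xi * rho x y \/
     rho (T x) (T y) <= eta * (rho x (T x) + rho y (T y)) \/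
     rho (T x) (T y) <= lambda * (rho x (T y) + rho y (T x))).
  (* For equal points, outside the scope of [T_contr], the first alternative holds because both
     sides vanish. *)
  { intros x y; destruct (classic (x = y)) as [<- | hxy].
    - left; unfold rho; rewrite !log_dist_refl by exact d_metric; lra.
    - destruct (T_contr x y hxy) as [h | [h | h]];
        apply log_dist_le_Rpower in h; try exact d_metric;
        try rewrite ln_mult in h by now apply mm_gt0.
      + now left.
      + now right; left.
      + now right; right. }
  set (delta := Rmax xi (Rmax (eta / (1 - eta)) (lambda / (1 - lambda)))).
  assert (hxi : xi <= delta) by apply Rmax_l.
  assert (heta : eta / (1 - eta) <= delta)
    by (eapply Rle_trans, Rmax_r; apply Rmax_l).
  assert (hlambda : lambda / (1 - lambda) <= delta)
    by (eapply Rle_trans, Rmax_r; apply Rmax_r).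
  (* The bound 1/2 on [eta] and [lambda] enters here: it makes both quotients less than 1. *)
  assert (hdelta : delta < 1)
    by (repeat apply Rmax_lub_lt; try apply div_compl_lt_1; lra).
  destruct M_nonempty as [x0].
  destruct (fixed_point_of_estimate M d d_metric d_complete T delta) as [z hz];
    [lra | | exact x0 |].
  { intros x y; apply zamfirescu_estimate with xi eta lambda; auto; lra. }
  exists z; split; [exact hz|]; intros y hy.
  apply (log_dist_eq0 M d d_metric); fold rho.
  assert (pos : 0 <= rho z y) by now apply log_dist_ge0.
  (* At two fixed points the alternatives bound [rho z y] by [xi * rho z y], by 0 and by
     [2 * lambda * rho z y]; as [xi] and [2 * lambda] are below 1, each forces [rho z y = 0]. *)
  destruct (contr z y) as [h | [h | h]]; rewrite hz, hy in h.
  - nra.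
  - unfold rho in h at 2 3; rewrite !log_dist_refl in h by exact d_metric; lra.
  - unfold rho in h at 3; rewrite log_dist_sym in h by exact d_metric.
    fold rho in h; nra.
Qed.
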